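(* Let $k$ be a field of characteristic zero, let $F=(f_1,\ldots,f_n)$ be an arbitrary $n$-tuple of elements of the polynomial algebra $P_n=k[x_1,\ldots,x_n]$, let $L_D=L_F$ be the Lie algebra generated by all right powers $D^{[m]}$ ($m\geq 1$) of $D=D_F$, and let $$(X+tF)^{-1}=X+tF_1+t^2F_2+\cdots+t^mF_m+\cdots$$ be the formal inverse to the endomorphism $X+tF$ of $k[t]^n$, where $X=(x_1,\ldots,x_n)$, $t$ is an independent parameter, and each $F_m$ is an $n$-tuple of elements of $P_n$. Then the Lie algebra $L_D$ is generated by all $D_{F_m}$ where $m\geq 1$.
   Context: Write $\partial_i=\partial/\partial x_i$. For an $n$-tuple $G=(g_1,\ldots,g_n)$ of elements of $P_n$ put $D_G=g_1\partial_1+\cdots+g_n\partial_n$, a derivation of $P_n$; every $k$-linear derivation of $P_n$ has this form for a unique $G$. The space of all derivations carries the left-symmetric product determined by $(a\partial_i)\cdot(b\partial_j)=\big(a\,\partial_i(b)\big)\partial_j$ for $a,b\in P_n$; equivalently $D\cdot D_G=D_{D(G)}$, with $D$ applied componentwise to $G$. The Witt algebra $W_n$ is the Lie algebra of all derivations of $P_n$ under the usual commutator bracket. The right powers of $D$ are $D^{[1]}=D$ and $D^{[r+1]}=D^{[r]}\cdot D$ for $r\ge 1$, and $L_D$ is the Lie subalgebra of $W_n$ generated by all $D^{[m]}$, $m\ge1$. The formal inverse is the inverse of $X+tF$ under composition, with coefficients in $P_n[[t]]$. *)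

(* Defs.v *)
From HB Require Import structures.
From mathcomp Require Import all_boot all_order all_algebra.
From mathcomp Require Import boolp.
From mathcomp Require Import mpoly ring.

Set Implicit Arguments.
Unset Strict Implicit.
Unset Printing Implicit Defensive.

Import GRing.Theory.
Local Open Scope ring_scope.

(* Formal power series R[[t]] in one parameter, as coefficient sequences with  *)
(* the Cauchy product.  Equality of series is equality of all coefficients     *)
(* by functional extensionality.                                               *)
Record fps (R : Type) := Fps { fps_coef : nat -> R }.

Lemma fps_coefK (R : Type) : cancel (@fps_coef R) (@Fps R).
Proof. by case. Qed.

HB.instance Definition _ (R : Type) := gen_eqMixin (fps R).
HB.instance Definition _ (R : Type) := gen_choiceMixin (fps R).

Section FpsRing.
Variable R : comNzRingType.
Implicit Types a b c : fps R.

Lemma fpsP a b : (forall m, fps_coef a m = fps_coef b m) -> a = b.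
Proof.
by move=> eq_ab; rewrite -[a]fps_coefK -[b]fps_coefK; congr Fps; apply: funext.
Qed.

Definition fps_const (r : R) := Fps (fun m => if m == 0%N then r else 0).
Definition fps_t : fps R := Fps (fun m => (m == 1%N)%:R).
Definition fps_add a b := Fps (fun m => fps_coef a m + fps_coef b m).
Definition fps_opp a := Fps (fun m => - fps_coef a m).
Definition fps_mul a b :=
  Fps (fun m => \sum_(j < m.+1) fps_coef a j * fps_coef b (m - j)).

Fact fps_addA : associative fps_add.
Proof. by move=> a b c; apply: fpsP => m /=; rewrite addrA. Qed.
Fact fps_addC : commutative fps_add.
Proof. by move=> a b; apply: fpsP => m /=; rewrite addrC. Qed.
Fact fps_add0 : left_id (fps_const 0) fps_add.
Proof. by move=> a; apply: fpsP => m /=; rewrite if_same add0r. Qed.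
Fact fps_addN : left_inverse (fps_const 0) fps_opp fps_add.
Proof. by move=> a; apply: fpsP => m /=; rewrite if_same addNr. Qed.

HB.instance Definition _ :=
  GRing.isZmodule.Build (fps R) fps_addA fps_addC fps_add0 fps_addN.

Let trunc N a : {poly R} := \poly_(j < N.+1) fps_coef a j.

Let coef_trunc N a j : (j <= N)%N -> (trunc N a)`_j = fps_coef a j.
Proof. by move=> jN; rewrite coef_poly ltnS jN. Qed.

Let coef_fps_mul N a b j :
  (j <= N)%N -> fps_coef (fps_mul a b) j = (trunc N a * trunc N b)`_j.
Proof.
move=> jN; rewrite coefM /=; apply: eq_bigr => i _; rewrite !coef_trunc //.
  exact: leq_trans (leq_subr _ _) jN.
by apply: leq_trans jN; rewrite -ltnS.
Qed.

Fact fps_mulA : associative fps_mul.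
Proof.
move=> a b c; apply: fpsP => m; rewrite [LHS]/= [RHS]/=.
transitivity ((trunc m a * (trunc m b * trunc m c))`_m).
  rewrite coefM; apply: eq_bigr => i _; rewrite coef_trunc; last by rewrite -ltnS.
  by rewrite -(coef_fps_mul (N := m)) // leq_subr.
rewrite mulrA coefM; apply: eq_bigr => i _.
by rewrite -coef_fps_mul -1?ltnS // coef_trunc // leq_subr.
Qed.

Fact fps_mulC : commutative fps_mul.
Proof.
by move=> a b; apply: fpsP => m; rewrite !(coef_fps_mul (N := m)) // mulrC.
Qed.

Fact fps_mul1 : left_id (fps_const 1) fps_mul.
Proof.
move=> a; apply: fpsP => m /=; rewrite big_ord_recl /= mul1r subn0.
by rewrite big1 ?addr0 // => i _; rewrite mul0r.
Qed.

Fact fps_mulDl : left_distributive fps_mul fps_add.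
Proof.
move=> a b c; apply: fpsP => m /=; rewrite -big_split /=.
by apply: eq_bigr => i _; rewrite mulrDl.
Qed.

Fact fps_1neq0 : fps_const 1 != 0.
Proof.
by apply/eqP => /(congr1 (fun a => fps_coef a 0)) /= /eqP; rewrite oner_eq0.
Qed.

HB.instance Definition _ := GRing.Zmodule_isComNzRing.Build (fps R)
  fps_mulA fps_mulC fps_mul1 fps_mulDl fps_1neq0.

End FpsRing.

Section FormalInverse.
Variables (k : fieldType) (n : nat).
Local Notation P := {mpoly k[n]}.

Definition fps_subst (B : n.-tuple (fps P)) (p : P) : fps P :=
  mmap (fun c : k => fps_const c%:MP) (tnth B) p.

(* Composition A o B of endomorphisms with coefficients in P[[t]]: if          *)
(* A_i = sum_j t^j a_{i,j}, then (A o B)_i = sum_j t^j a_{i,j}(B); the         *)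
(* coefficient of t^m in this t-adically convergent sum is a finite sum.       *)
Definition fps_comp (A B : n.-tuple (fps P)) : n.-tuple (fps P) :=
  [tuple Fps (fun m => \sum_(j < m.+1)
      fps_coef (fps_subst B (fps_coef (tnth A i) j)) (m - j)) | i < n].

Definition fps_id : n.-tuple (fps P) := [tuple fps_const 'X_i | i < n].

Definition X_plus_t (F : n.-tuple P) : n.-tuple (fps P) :=
  [tuple fps_const 'X_i + fps_t P * fps_const (tnth F i) | i < n].

(* X + t F_1 + t^2 F_2 + ...; the value Fs 0 is not used. *)
Definition X_plus_series (Fs : nat -> n.-tuple P) : n.-tuple (fps P) :=
  [tuple Fps (fun m => if m == 0%N then 'X_i else tnth (Fs m) i) | i < n].

Definition formal_inverse (F : n.-tuple P) (Fs : nat -> n.-tuple P) : Prop :=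
  fps_comp (X_plus_t F) (X_plus_series Fs) = fps_id /\
  fps_comp (X_plus_series Fs) (X_plus_t F) = fps_id.

End FormalInverse.

Section Witt.
Variables (k : fieldType) (n : nat).
Local Notation P := {mpoly k[n]}.
Implicit Types (D E : P -> P) (S L : (P -> P) -> Prop).

Definition derivation D : Prop :=
  linear D /\ forall p q, D (p * q) = D p * q + p * D q.

Definition vfield (G : n.-tuple P) : P -> P :=
  fun p => \sum_(i < n) tnth G i * p^`M(i).

(* D . D_G = D_{D(G)}, where a derivation E is D_G for g_i = E(x_i). *)
Definition lsprod D E : P -> P := vfield [tuple D (E 'X_i) | i < n].

(* D^[m] for m >= 1; the value at m = 0 is not used. *)
Definition rpow D (m : nat) : P -> P := iter m.-1 (fun E => lsprod E D) D.

Definition bracket D E : P -> P := fun p => D (E p) - E (D p).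

(* Lie subalgebras of the Witt algebra W_n of all derivations of P_n. *)
Record lie_subalgebra L : Prop := LieSubalgebra {
  lie_derivation : forall D, L D -> derivation D;
  lie_zero : L (fun _ => 0);
  lie_add : forall D E, L D -> L E -> L (fun p => D p + E p);
  lie_scale : forall (a : k) D, L D -> L (fun p => a *: D p);
  lie_bracket : forall D E, L D -> L E -> L (bracket D E) }.

(* Meaningful only for S a set of derivations. *)
Definition lie_generated S : (P -> P) -> Prop :=
  fun D => forall L, lie_subalgebra L -> (forall E, S E -> L E) -> L D.

Definition L_of D : (P -> P) -> Prop :=
  lie_generated (fun E => exists2 m, (0 < m)%N & E = rpow D m).

Lemma vfield_derivation G : derivation (vfield G).
Proof.
split=> [a p q | p q]; rewrite /vfield.
  rewrite scaler_sumr -big_split; apply: eq_bigr => i _ /=.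
  by rewrite linearP mulrDr scalerAr.
rewrite mulr_suml mulr_sumr -big_split; apply: eq_bigr => i _ /=.
by rewrite mderivM; ring.
Qed.

Lemma rpow_derivation D m : derivation D -> derivation (rpow D m).
Proof. by rewrite /rpow; case: m.-1 => // j _; apply: vfield_derivation. Qed.

Lemma derivation_lie_subalgebra : lie_subalgebra derivation.
Proof.
split=> // [|D E [lD mD] [lE mE]|a D [lD mD]|D E [lD mD] [lE mE]].
- by split=> [c p q|p q]; rewrite ?scaler0 ?mul0r ?mulr0 addr0.
- split=> [c p q|p q]; first by rewrite lD lE scalerDr addrACA.
  by rewrite mD mE mulrDl mulrDr addrACA.
- split=> [c p q|p q]; first by rewrite lD scalerDr !scalerA mulrC.
  by rewrite mD scalerDr scalerAl scalerAr.
have addD p q : D (p + q) = D p + D q by rewrite -[p]scale1r lD !scale1r.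
have addE p q : E (p + q) = E p + E q by rewrite -[p]scale1r lE !scale1r.
rewrite /bracket; split=> [c p q|p q].
  by rewrite lE lD lD lE scalerBr opprD addrACA.
rewrite mE mD addD addE !mD !mE; ring.
Qed.

End Witt.

(* Main.v *)
Require Import Defs.
From HB Require Import structures.
From mathcomp Require Import all_boot all_order all_algebra.
From mathcomp Require Import mpoly.
From mathcomp Require Import boolp ring.

Set Implicit Arguments.
Unset Strict Implicit.
Unset Printing Implicit Defensive.

Import GRing.Theory.
Local Open Scope ring_scope.

(** Let Y = X + t F_1 + t^2 F_2 + ..., so that Y + t F(Y) = X, and let phi be the
    substitution p |-> p(Y), a k-algebra morphism from polynomials to power
    series in t with phi = id modulo t.  Put

      V = sum_(r >= 1) (-t)^r D^[r],     U = sum_(r >= 1) t^r D_(F_r).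

    The coefficients of D^[r] are J^(r-1) F, where J is the Jacobian matrix of F,
    so V is the vector field - t (1 + t J)^(-1) F, while U is the vector field
    Y - X.  The point is that phi satisfies two differential equations, one on
    each side:

      t phi' = phi V     and     t phi' = U phi.

    The first is the t-derivative of Y + t F(Y) = X, solved for t Y' by iterating
    a geometric series ([flow_right_subst]).  The second is the inviscid Burgers
    equation t Y' = sum_i (Y_i - X_i) dY/dx_i: the derivation
    delta = t d/dt - sum_i (Y_i - X_i) d/dx_i, applied to Y + t F(Y) = X, gives
    delta Y = - t J(Y) delta Y, which forces delta Y = 0 ([flow_left_subst]).

    Consequently U = phi V phi^(-1).  For a constant derivation A, the
    conjugate phi A phi^(-1) satisfies t (phi A phi^(-1))' = phi [V, A] phi^(-1),
    so its coefficients are obtained from A by iterated brackets with the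
    coefficients of V, divided by integers: this is where characteristic zero
    enters.  Reading off the coefficient of t^s in U = phi V phi^(-1),

      D_(F_s) = (-1)^s D^[s] + (Lie polynomial in D^[1], ..., D^[s-1]),

    a triangular relation, so a Lie subalgebra contains all the D_(F_s) if and
    only if it contains all the D^[s] ([flow_generators]). *)

(** * Triangular sums *)

Lemma triangle_sum_diag (V : zmodType) (f : nat -> nat -> V) m :
  \sum_(r < m) \sum_(i < m - r) f r i = \sum_(s < m) \sum_(r < s.+1) f r (s - r)%N.
Proof.
elim: m => [|m IHm]; first by rewrite !big_ord0.
rewrite [RHS]big_ord_recr /= -IHm.
have {1}-> : \sum_(r < m.+1) \sum_(i < m.+1 - r) f r i =
    \sum_(r < m.+1) (\sum_(i < m - r) f r i + f r (m - r)%N).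
  by apply: eq_bigr => r _; rewrite subSn -1?ltnS // big_ord_recr.
by rewrite big_split big_ord_recr /= subnn big_ord0 addr0.
Qed.

Lemma triangle_sum_swap (V : zmodType) (f : nat -> nat -> V) m :
  \sum_(r < m) \sum_(i < m - r) f r i = \sum_(i < m) \sum_(r < m - i) f r i.
Proof.
rewrite triangle_sum_diag (triangle_sum_diag (fun i r => f r i)).
apply: eq_bigr => s _; rewrite (reindex_inj rev_ord_inj) /=.
by apply: eq_bigr => r _; rewrite subSS subKn // -ltnS.
Qed.

(** * Lie subalgebras *)

Section LieSubalgebra.

Variables (k : fieldType) (n : nat).
Local Notation P := {mpoly k[n]}.
Variables (L : (P -> P) -> Prop) (lieL : lie_subalgebra L).
Implicit Types (A B : P -> P).

Lemma lie_sum {I : Type} (r : seq I) (Q : pred I) (A : I -> P -> P) :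
  (forall i, Q i -> L (A i)) -> L (fun p => \sum_(i <- r | Q i) A i p).
Proof.
move=> LA; elim: r => [|i r IHr].
  have -> : (fun p => \sum_(i <- [::] | Q i) A i p) = (fun=> 0).
    by apply: funext => p; rewrite big_nil.
  exact: lie_zero lieL.
have -> : (fun p => \sum_(j <- i :: r | Q j) A j p) =
    if Q i then (fun p => A i p + \sum_(j <- r | Q j) A j p)
    else (fun p => \sum_(j <- r | Q j) A j p).
  by case: ifP => Qi; apply: funext => p; rewrite big_cons Qi.
by case: ifP => // Qi; apply: (lie_add lieL) (LA i Qi) IHr.
Qed.

Lemma lie_sub A B : L A -> L B -> L (fun p => A p - B p).
Proof.
move=> LA LB; have := lie_add lieL LA (lie_scale lieL (-1) LB).
by congr L; apply: funext => p; rewrite scaleN1r.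
Qed.

Lemma lieD A p q : L A -> A (p + q) = A p + A q.
Proof. by move/(lie_derivation lieL) => [lA _]; rewrite -[p]scale1r lA !scale1r. Qed.

(** Elements of L are bare functions; this gives access to the theory of additive
    maps. *)
Lemma lie_add_morph A : L A -> exists f : {additive P -> P}, f =1 A.
Proof.
move=> LA.
have aA : zmod_morphism A.
  by move=> p q; rewrite -{2}(subrK q p) (lieD (p - q)) // addrK.
pose m := GRing.isZmodMorphism.Build _ _ A aA.
pose f : {additive P -> P} := HB.pack A m.
by exists f.
Qed.

Lemma lie_sumr A (LA : L A) (I : Type) (r : seq I) (Q : pred I) (F : I -> P) :
  A (\sum_(i <- r | Q i) F i) = \sum_(i <- r | Q i) A (F i).
Proof.
have [f fA] := lie_add_morph LA; rewrite -fA raddf_sum.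
by apply: eq_bigr => i _; rewrite fA.
Qed.

Lemma lieMn A p m : L A -> A (p *+ m) = A p *+ m.
Proof. by move=> LA; have [f fA] := lie_add_morph LA; rewrite -!fA raddfMn. Qed.

End LieSubalgebra.

(** * Conjugation by a formal flow *)

(** Here phi_m, w_r, u_r stand for the coefficients of t^m in phi, of t^(r+1) in V
    and of t^(r+1) in U; the shift of indices makes the sequences of vector fields
    start at 0. *)

Section Conjugation.

Variables (k : fieldType) (n : nat).
Hypothesis char0 : [pchar k] =i pred0.
Local Notation P := {mpoly k[n]}.
Implicit Types (A : P -> P) (w u : nat -> P -> P) (phi : nat -> P -> P).

(** The coefficient B_m of t^m in the conjugate of A is determined by B_0 = A and
    m B_m = sum_(r < m) B'_(m - r - 1), where B' belongs to [w r, A].  This is a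
    course-of-values recursion in m for all A at once, so [conj_upto w N] is a
    table valid for m <= N. *)
Fixpoint conj_upto w (N : nat) : nat -> (P -> P) -> P -> P :=
  if N isn't N'.+1 then fun _ A => A else
  fun m A => if (m <= N')%N then conj_upto w N' m A else
  fun p => m%:R^-1 *: \sum_(r < m) conj_upto w N' (m - r.+1) (bracket (w r) A) p.

Definition conj_coef w m := conj_upto w m m.

Lemma conj_uptoE w N m A : (m <= N)%N -> conj_upto w N m A = conj_coef w m A.
Proof.
elim: N => [|N IHN] in m *; first by case: m.
rewrite leq_eqVlt => /predU1P[-> //|]; rewrite ltnS => le_mN /=.
by rewrite le_mN IHN.
Qed.

Lemma conj_coef0 w A : conj_coef w 0 A = A. Proof. by []. Qed.

Lemma pmulrnIn_char0 (V : lmodType k) m : injective (fun x : V => x *+ m.+1).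
Proof.
move=> x y; rewrite -!scaler_nat; apply: scalerI.
by rewrite ((pcharf0P k).1 char0).
Qed.

Lemma conj_coefS w m A p :
  conj_coef w m.+1 A p *+ m.+1 =
  \sum_(r < m.+1) conj_coef w (m - r) (bracket (w r) A) p.
Proof.
rewrite /conj_coef /= ltnn -scaler_nat scalerA divff ?scale1r; last first.
  by rewrite ((pcharf0P k).1 char0).
by apply: eq_bigr => r _; rewrite subSS conj_uptoE // leq_subr.
Qed.

Lemma lie_conj_coef L w m A : lie_subalgebra L ->
  (forall r, (r < m)%N -> L (w r)) -> L A -> L (conj_coef w m A).
Proof.
move=> lieL; have [N] := ubnP m; elim: N => // N IHN in m A *.
case: m => // m; rewrite ltnS => lt_mN Lw LA.
rewrite /conj_coef /= ltnn; apply: (lie_scale lieL).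
apply: (lie_sum lieL) => r _; rewrite subSS conj_uptoE ?leq_subr //.
apply: IHN; first exact: leq_ltn_trans (leq_subr _ _) lt_mN.
  by move=> q lt_qmr; apply: Lw; apply: leq_trans lt_qmr _; rewrite leqW ?leq_subr.
by apply: (lie_bracket lieL) => //; apply: Lw.
Qed.

Section Flow.

Variables (phi u w : nat -> P -> P) (L : (P -> P) -> Prop).
Hypothesis lieL : lie_subalgebra L.
Hypothesis phi0 : forall p, phi 0 p = p.
Hypothesis phiD : forall m p q, phi m (p + q) = phi m p + phi m q.
Hypothesis flow_right : forall m p,
  phi m p *+ m = \sum_(r < m) phi (m - r.+1)%N (w r p).

(** This is phi A = (phi A phi^(-1)) phi.  Both sides satisfy the same equation:
    multiplying by m and using t phi' = phi V turns phi_r (w_r A) into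
    phi_r ([w_r, A] + A w_r); the brackets account for the derivative of the
    conjugate of A and the other terms for the derivative of phi. *)
Lemma conj_coefP m A p : (forall r, (r < m)%N -> L (w r)) -> L A ->
  phi m (A p) = \sum_(i < m.+1) conj_coef w i A (phi (m - i)%N p).
Proof.
have [N] := ubnP m; elim: N => // N IHN in m A p *.
case: m => [|m]; first by rewrite big_ord1 subn0 !phi0.
rewrite ltnS => lt_mN Lw LA; apply: (pmulrnIn_char0 (m := m)) => /=.
have lt_subN i : (m - i < N)%N by exact: leq_ltn_trans (leq_subr _ _) lt_mN.
have Lw_sub i r : (r < m - i)%N -> L (w r).
  by move=> lt_r; apply: Lw; apply: leq_trans lt_r _; rewrite leqW ?leq_subr.
rewrite flow_right.
have split_w (r : 'I_m.+1) : phi (m.+1 - r.+1)%N (w r (A p)) =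
    \sum_(i < m.+1 - r) conj_coef w i (bracket (w r) A) (phi (m - r - i)%N p) +
    \sum_(i < m.+1 - r) conj_coef w i A (phi (m - r - i)%N (w r p)).
  have le_rm : (r <= m)%N by rewrite -ltnS.
  rewrite (_ : w r (A p) = bracket (w r) A p + A (w r p)); last by rewrite subrK.
  rewrite phiD subSS subSn //; congr (_ + _).
    apply: IHN => //; first exact: Lw_sub.
    by apply: (lie_bracket lieL) => //; apply: Lw.
  by apply: IHN => //; exact: Lw_sub.
rewrite (eq_bigr _ (fun r _ => split_w r)).
rewrite big_split /=.
(* Group the brackets by the index s of phi_(m - s), and the other terms by the
   index i of the conjugate of A. *)
rewrite (triangle_sum_diag
  (fun r i => conj_coef w i (bracket (w r) A) (phi (m - r - i)%N p))).
rewrite (triangle_sum_swap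
  (fun r i => conj_coef w i A (phi (m - r - i)%N (w r p)))).
have -> : \sum_(s < m.+1) \sum_(r < s.+1)
     conj_coef w (s - r) (bracket (w r) A) (phi (m - r - (s - r))%N p) =
   \sum_(i < m.+2) conj_coef w i A (phi (m.+1 - i)%N p) *+ i.
  rewrite [RHS]big_ord_recl mulr0n add0r; apply: eq_bigr => s _ /=.
  rewrite /bump leq0n add1n conj_coefS; apply: eq_bigr => r _.
  by rewrite subSS -subnDA subnKC // -ltnS.
have -> : \sum_(i < m.+1) \sum_(r < m.+1 - i)
     conj_coef w i A (phi (m - r - i)%N (w r p)) =
   \sum_(i < m.+2) conj_coef w i A (phi (m.+1 - i)%N p) *+ (m.+1 - i).
  rewrite [RHS]big_ord_recr /= subnn mulr0n addr0; apply: eq_bigr => i _.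
  have Li : L (conj_coef w i A).
    apply: lie_conj_coef => // r lt_ri; apply: Lw; exact: ltn_trans lt_ri _.
  rewrite -(lieMn lieL) // flow_right (lie_sumr lieL) //.
  by apply: eq_bigr => r _; rewrite (subnAC m.+1) subSS.
rewrite -big_split -sumrMnl; apply: eq_bigr => i _ /=.
by rewrite -mulrnDr subnKC // -ltnS.
Qed.

Hypothesis flow_left : forall m p,
  phi m p *+ m = \sum_(r < m) u r (phi (m - r.+1)%N p).

(** The coefficient of t^(s+1) in U phi = phi V = (phi V phi^(-1)) phi.  Since
    phi_0 = id, the factor phi can be cancelled one coefficient at a time; only
    w_0, ..., w_(s-1) are conjugated, so w_s itself may lie outside L. *)
Lemma flow_left_conj s : (forall r, (r < s)%N -> L (w r)) -> forall p,
  u s p = \sum_(r < s.+1) conj_coef w (s - r) (w r) p.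
Proof.
have [N] := ubnP s; elim: N => // N IHN in s *.
rewrite ltnS => lt_sN Lw p.
have := flow_right s.+1 p; rewrite flow_left.
have -> : \sum_(r < s.+1) phi (s.+1 - r.+1)%N (w r p) =
    \sum_(r < s.+1) \sum_(i < s.+1 - r) conj_coef w i (w r) (phi (s - r - i)%N p).
  apply: eq_bigr => r _; rewrite subSS subSn -1?ltnS //.
  have := ltn_ord r; rewrite ltnS leq_eqVlt => /predU1P[->|lt_rs].
    by rewrite subnn big_ord1 !phi0.
  apply: conj_coefP; last exact: Lw.
  move=> q lt_q; apply: Lw; exact: leq_trans lt_q (leq_subr _ _).
rewrite (triangle_sum_diag
  (fun r i => conj_coef w i (w r) (phi (s - r - i)%N p))).
rewrite big_ord_recr /= [in RHS]big_ord_recr /= subSS subnn phi0.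
have -> : \sum_(r < s.+1) conj_coef w (s - r) (w r) (phi (s - r - (s - r))%N p) =
   \sum_(r < s.+1) conj_coef w (s - r) (w r) p.
  by apply: eq_bigr => r _; rewrite subnn phi0.
set a := (X in X + _); set b := (X in _ = X + _) => E.
suff ab : a = b by apply: (addrI a); rewrite E ab.
apply: eq_bigr => j _; rewrite subSS IHN; last first.
- by move=> r lt_rj; apply: Lw; apply: ltn_trans lt_rj _.
- by apply: leq_trans (ltn_ord j) _.
by apply: eq_bigr => r _; rewrite -subnDA subnKC // -ltnS.
Qed.

Lemma flow_left_mod s : (forall r, (r < s)%N -> L (w r)) ->
  L (fun p => u s p - w s p).
Proof.
move=> Lw.
have -> : (fun p => u s p - w s p) =
    (fun p => \sum_(r < s) conj_coef w (s - r) (w r) p).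
  apply: funext => p; rewrite flow_left_conj // big_ord_recr /= subnn.
  by rewrite conj_coef0 addrK.
apply: (lie_sum lieL) => r _; apply: lie_conj_coef => //; last exact: Lw.
by move=> q lt_q; apply: Lw; exact: leq_trans lt_q (leq_subr _ _).
Qed.

(** The relation u_s = w_s modulo L is triangular, hence can be inverted by
    induction on s. *)
Lemma flow_generators :
  (forall r, L (w r)) <-> (forall r, L (u r)).
Proof.
split=> [Lw s|Lu s].
  have := lie_add lieL (flow_left_mod (fun r _ => Lw r) (s := s)) (Lw s).
  by congr L; apply: funext => p; rewrite subrK.
have [N] := ubnP s; elim: N => // N IHN in s *; rewrite ltnS => lt_sN.
have Lw r : (r < s)%N -> L (w r) by move=> lt_rs; apply: IHN; apply: leq_trans lt_sN.
have := lie_sub lieL (Lu s) (flow_left_mod Lw).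
by congr L; apply: funext => p; rewrite subKr.
Qed.

End Flow.

End Conjugation.

(** * Calculus of power series *)

Lemma fps_coef0 (R : comNzRingType) m : fps_coef (0 : fps R) m = 0.
Proof. by case: m. Qed.

Lemma fps_coefD (R : comNzRingType) (a b : fps R) m :
  fps_coef (a + b) m = fps_coef a m + fps_coef b m.
Proof. by []. Qed.

Lemma fps_coefN (R : comNzRingType) (a : fps R) m :
  fps_coef (- a) m = - fps_coef a m.
Proof. by []. Qed.

Lemma fps_coefM (R : comNzRingType) (a b : fps R) m :
  fps_coef (a * b) m = \sum_(j < m.+1) fps_coef a j * fps_coef b (m - j)%N.
Proof. by []. Qed.

Lemma fps_coef_sum (R : comNzRingType) (I : Type) (r : seq I) (Q : pred I)
    (a : I -> fps R) m :
  fps_coef (\sum_(i <- r | Q i) a i) m = \sum_(i <- r | Q i) fps_coef (a i) m.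
Proof.
by apply: (big_morph (fun b : fps R => fps_coef b m)) => //=; case: m.
Qed.

Lemma fps_coef_constM (R : comNzRingType) (c : R) (a : fps R) m :
  fps_coef (fps_const c * a) m = c * fps_coef a m.
Proof.
rewrite fps_coefM big_ord_recl /= subn0 big1 ?addr0 // => i _.
by rewrite mul0r.
Qed.

Lemma fps_coef_tM (R : comNzRingType) (a : fps R) m :
  fps_coef (fps_t R * a) m = if m is m'.+1 then fps_coef a m' else 0.
Proof.
rewrite fps_coefM; case: m => [|m]; first by rewrite big_ord1 mul0r.
rewrite big_ord_recl big_ord_recl /= mul0r add0r mul1r subSS subn0.
by rewrite big1 ?addr0 // => i _; rewrite mul0r.
Qed.

Lemma fps_coef_NtXM (R : comNzRingType) (a : fps R) r m :
  fps_coef ((- fps_t R) ^+ r * a) m =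
  if (r <= m)%N then (-1) ^+ r * fps_coef a (m - r)%N else 0.
Proof.
elim: r m => [|r IHr] m; first by rewrite !mul1r subn0.
rewrite exprS -mulrA mulNr fps_coefN fps_coef_tM.
case: m => [|m]; first by rewrite oppr0.
rewrite IHr subSS ltnS; case: ifP => _; last by rewrite oppr0.
by rewrite exprS mulN1r mulNr.
Qed.

Lemma fps_const_is_zmod_morphism (R : comNzRingType) :
  zmod_morphism (@fps_const R).
Proof. by move=> a b; apply: fpsP => -[|m] //=; rewrite subr0. Qed.

Lemma fps_const_is_monoid_morphism (R : comNzRingType) :
  monoid_morphism (@fps_const R).
Proof.
split=> // a b; apply: fpsP => m; rewrite fps_coef_constM /=.
by case: m => //=; rewrite mulr0.
Qed.

HB.instance Definition _ (R : comNzRingType) :=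
  GRing.isZmodMorphism.Build R (fps R) (@fps_const R)
    (@fps_const_is_zmod_morphism R).
HB.instance Definition _ (R : comNzRingType) :=
  GRing.isMonoidMorphism.Build R (fps R) (@fps_const R)
    (@fps_const_is_monoid_morphism R).

(** Multiplication by t raises the order of vanishing, so Z is divisible by every
    power of t. *)
Lemma fps_contraction_eq0 (R : comNzRingType) n (M : 'I_n -> 'I_n -> fps R)
    (Z : 'I_n -> fps R) :
  (forall i, Z i = - (fps_t R * \sum_(j < n) M i j * Z j)) ->
  forall i, Z i = 0.
Proof.
move=> ZE; suff Z0 m : forall i, fps_coef (Z i) m = 0.
  by move=> i; apply: fpsP => m; rewrite Z0 /=; case: m.
have [N] := ubnP m; elim: N => // N IHN in m *; rewrite ltnS => lt_mN i.
rewrite ZE fps_coefN fps_coef_tM; case: m lt_mN => [|m] lt_mN; rewrite ?oppr0 //.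
rewrite fps_coef_sum big1 ?oppr0 // => j _; rewrite fps_coefM big1 // => l _.
by rewrite IHN ?mulr0 //; apply: leq_ltn_trans (leq_subr _ _) lt_mN.
Qed.

(** The derivation t d/dt; compared with d/dt it does not shift coefficients. *)
Definition euler (R : comNzRingType) (a : fps R) : fps R :=
  Fps (fun m => fps_coef a m *+ m).

Lemma eulerD (R : comNzRingType) (a b : fps R) : euler (a + b) = euler a + euler b.
Proof. by apply: fpsP => m; rewrite /= mulrnDl. Qed.

Lemma eulerM (R : comNzRingType) (a b : fps R) :
  euler (a * b) = euler a * b + a * euler b.
Proof.
apply: fpsP => m; rewrite /= -sumrMnl -big_split; apply: eq_bigr => i _ /=.
by rewrite mulrnAl mulrnAr -mulrnDr subnKC // -ltnS.
Qed.

Lemma euler_const (R : comNzRingType) (c : R) : euler (fps_const c) = 0.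
Proof. by apply: fpsP => -[|m] //=; rewrite mul0rn. Qed.

Lemma euler_t (R : comNzRingType) : euler (fps_t R) = fps_t R.
Proof. by apply: fpsP => -[|[|m]] //=; rewrite mul0rn. Qed.

Lemma sum_leibniz (R : comNzRingType) (I : Type) (r : seq I) (a b : R) (f g d : I -> R) :
  (\sum_(i <- r) f i * d i) * b + a * (\sum_(i <- r) g i * d i) =
  \sum_(i <- r) (f i * b + a * g i) * d i.
Proof.
rewrite mulr_suml mulr_sumr -big_split; apply: eq_bigr => i _ /=; ring.
Qed.

Lemma sum_scale (R : comNzRingType) (I : Type) (r : seq I) (c s x : R) (f g : I -> R) :
  c * (\sum_(i <- r) f i * g i + s * x) =
  \sum_(i <- r) f i * (g i * c) + s * (c * x).
Proof.
rewrite mulrDr mulr_sumr mulrCA; congr (_ + _).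
by apply: eq_bigr => i _; rewrite mulrCA (mulrC c).
Qed.

Section Substitution.

Variables (k : fieldType) (n : nat).
Local Notation P := {mpoly k[n]}.
Implicit Types (p q : P) (a b : fps P) (B Y : n.-tuple (fps P)).

Lemma mpoly_closed_ind (Q : P -> Prop) :
  (forall c, Q c%:MP) -> (forall i, Q 'X_i) ->
  (forall p q, Q p -> Q q -> Q (p + q)) ->
  (forall p q, Q p -> Q q -> Q (p * q)) -> forall p, Q p.
Proof.
move=> QC QX QD QM p; rewrite [p]mpolyE; apply: (big_ind Q) => //.
  by rewrite -mpolyC0.
move=> m _; rewrite -mul_mpolyC mpolyXE_id; apply: (QM) => //.
apply: (big_ind Q) => // [|i _]; first by rewrite -mpolyC1.
by elim: (m i) => [|e IHe]; rewrite ?expr0 -?mpolyC1 // exprS; apply: QM.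
Qed.

Lemma mderivU i j : ('X_j : P)^`M(i) = (i == j)%:R.
Proof.
have subUU l : (U_(l) - U_(l) = 0 :> 'X_{1..n})%MM.
  by apply/mnmP => h; rewrite mnmBE mnm0E subnn.
rewrite mderivX mnm1E [RHS]/= eq_sym.
by case: eqP => [->|_]; rewrite ?scale0r // subUU mpolyX0 scale1r.
Qed.

(** The same function as the scalar map inside [fps_subst], named so that it can
    carry its ring morphism structure. *)
Definition fps_scalar (c : k) : fps P := fps_const c%:MP.
HB.instance Definition _ := GRing.RMorphism.copy fps_scalar
  (@fps_const P \o @mpolyC n k).

Lemma fps_substE B : fps_subst B = mmap fps_scalar (tnth B).
Proof. by []. Qed.

Lemma fps_substC B c : fps_subst B c%:MP = fps_scalar c.
Proof. by rewrite fps_substE mmapC. Qed.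

Lemma fps_substU B i : fps_subst B 'X_i = tnth B i.
Proof. by rewrite fps_substE mmapX mmap1U. Qed.

Lemma fps_subst0 B : fps_subst B 0 = 0.
Proof. by rewrite fps_substE raddf0. Qed.

Lemma fps_subst1 B : fps_subst B 1 = 1.
Proof. by rewrite fps_substE rmorph1. Qed.

Lemma fps_substD B p q : fps_subst B (p + q) = fps_subst B p + fps_subst B q.
Proof. by rewrite fps_substE mmapD. Qed.

Lemma fps_substM B p q : fps_subst B (p * q) = fps_subst B p * fps_subst B q.
Proof. by rewrite fps_substE rmorphM. Qed.

Lemma fps_subst_sum B (I : Type) (r : seq I) (Q : pred I) (f : I -> P) :
  fps_subst B (\sum_(i <- r | Q i) f i) = \sum_(i <- r | Q i) fps_subst B (f i).
Proof. by rewrite fps_substE raddf_sum. Qed.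

Lemma fps_coef_substZ B c p m :
  fps_coef (fps_subst B (c *: p)) m = c *: fps_coef (fps_subst B p) m.
Proof.
by rewrite -mul_mpolyC fps_substM fps_substC fps_coef_constM mul_mpolyC.
Qed.

Record series_derivation (delta : fps P -> fps P) : Prop := SeriesDerivation {
  sderD : forall a b, delta (a + b) = delta a + delta b;
  sderM : forall a b, delta (a * b) = delta a * b + a * delta b;
  sderC : forall c, delta (fps_scalar c) = 0 }.

(** Both sides are derivations along the morphism p |-> p(B), so it is enough that
    they agree on the variables. *)
Lemma fps_subst_chain delta B p : series_derivation delta ->
  delta (fps_subst B p) =
  \sum_(j < n) fps_subst B p^`M(j) * delta (tnth B j).
Proof.
move=> [dD dM dC]; elim/mpoly_closed_ind: p => [c|i|p q IHp IHq|p q IHp IHq].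
- rewrite fps_substC dC big1 // => j _.
  by rewrite mderivC fps_subst0 mul0r.
- rewrite fps_substU (bigD1 i) //= big1 ?addr0 => [|j ne_ji].
    by rewrite mderivU eqxx fps_subst1 mul1r.
  by rewrite mderivU (negPf ne_ji) fps_subst0 mul0r.
- rewrite fps_substD dD (congr2 +%R IHp IHq) -big_split.
  apply: eq_bigr => j _ /=.
  by rewrite mderivD fps_substD mulrDl.
rewrite fps_substM dM.
rewrite [LHS](congr2 (fun a b => a * fps_subst B q + fps_subst B p * b) IHp IHq).
rewrite sum_leibniz; apply: eq_bigr => j _.
by rewrite mderivM fps_substD !fps_substM.
Qed.

Lemma euler_derivation : series_derivation (@euler P).
Proof.
split; [exact: eulerD|exact: eulerM|by move=> c; exact: euler_const].
Qed.

Definition fps_deriv (i : 'I_n) a : fps P := Fps (fun m => (fps_coef a m)^`M(i)).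

Lemma fps_deriv_derivation i : series_derivation (fps_deriv i).
Proof.
split=> [a b|a b|c]; apply: fpsP => m /=; first by rewrite mderivD.
  rewrite (raddf_sum (mderiv i)) -big_split; apply: eq_bigr => j _ /=.
  exact: mderivM.
by case: m => [|m]; rewrite ?mderivC ?mderiv0.
Qed.

End Substitution.

(** * The flow of the formal inverse *)

Section Inverse.

Variables (k : fieldType) (n : nat).
Local Notation P := {mpoly k[n]}.
Local Notation t := (fps_t P).
Variables (F : n.-tuple P) (Fs : nat -> n.-tuple P).
Local Notation Y := (X_plus_series Fs).
Local Notation phi := (fps_subst Y).

Lemma vfieldU (G : n.-tuple P) i : vfield G 'X_i = tnth G i.
Proof.
rewrite /vfield (bigD1 i) //= big1 ?addr0 => [|j ne_ji].
  by rewrite mderivU eqxx mulr1.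
by rewrite mderivU (negPf ne_ji) mulr0.
Qed.

Hypothesis right_inv : fps_comp (X_plus_t F) Y = fps_id k n.

(** The functional equation Y + t F(Y) = X, from which everything else follows. *)
Lemma right_inverse_eq i :
  tnth Y i + t * phi (tnth F i) = fps_const 'X_i.
Proof.
have := congr1 (fun B => tnth B i) right_inv.
rewrite /= [tnth (fps_id _ _) i]tnth_mktuple => <-.
rewrite [tnth (fps_comp _ _) i]tnth_mktuple; apply: fpsP => m; rewrite fps_coefD fps_coef_tM /=.
have coef j : fps_coef (fps_const 'X_i + t * fps_const (tnth F i)) j =
    if j is j'.+1 then if j' is 0 then tnth F i else 0 else 'X_i.
  rewrite fps_coefD fps_coef_tM; case: j => [|[|j]] /=; rewrite ?addr0 ?add0r //.
under eq_bigr => j _ do rewrite tnth_mktuple coef.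
case: m => [|m].
  by rewrite big_ord1 fps_substU addr0.
rewrite !big_ord_recl /= big1 => [|j _]; last by rewrite fps_subst0 fps_coef0.
by rewrite addr0 fps_substU /bump /= subn0 addn0 subn1.
Qed.

Lemma fps_coef0_subst p : fps_coef (phi p) 0 = p.
Proof.
elim/mpoly_closed_ind: p => [c|i|p q IHp IHq|p q IHp IHq].
- by rewrite fps_substC.
- by rewrite fps_substU tnth_mktuple.
- rewrite fps_substD fps_coefD.
  exact: (congr2 +%R IHp IHq).
rewrite fps_substM fps_coefM big_ord1.
exact: (congr2 *%R IHp IHq).
Qed.

(** The derivation t d/dt - U, whose kernel consists of the solutions of the
    transport equation along the vector field U = Y - X. *)
Definition transport (a : fps P) : fps P :=
  euler a - \sum_(i < n) (tnth Y i - fps_const 'X_i) * fps_deriv i a.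

Lemma transport_derivation : series_derivation transport.
Proof.
have [eD eM eC] := @euler_derivation k n.
split=> [a b|a b|c]; rewrite /transport.
- rewrite eD addrACA -opprD -big_split; congr (_ + _ - _).
  by apply: eq_bigr => i _; rewrite (sderD (fps_deriv_derivation k i)) mulrDr.
- rewrite eM mulrBl mulrBr addrACA -opprD mulr_suml mulr_sumr -big_split.
  congr (_ + _ - _); apply: eq_bigr => i _.
  by rewrite (sderM (fps_deriv_derivation k i)) /=; ring.
rewrite eC big1 ?subr0 // => i _.
by rewrite (sderC (fps_deriv_derivation k i)) mulr0.
Qed.

Lemma transport_t a : transport (t * a) = t * a + t * transport a.
Proof.
rewrite (sderM transport_derivation); congr (_ * _ + _).
rewrite /transport euler_t big1 ?subr0 // => i _.
suff -> : fps_deriv i t = 0 by rewrite mulr0.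
apply: fpsP => m /=; rewrite -mpolyC_nat mderivC; by case: m.
Qed.

Lemma transport_const i :
  transport (fps_const 'X_i) = fps_const 'X_i - tnth Y i.
Proof.
have deriv_X j : fps_deriv j (fps_const 'X_i) = fps_const ((j == i)%:R : P).
  by apply: fpsP => -[|m] /=; rewrite ?mderivU ?mderiv0.
rewrite /transport euler_const sub0r (bigD1 i) //= big1 ?addr0 => [|j ne_ji].
  by rewrite deriv_X eqxx rmorph1 mulr1 opprB.
by rewrite deriv_X (negPf ne_ji) rmorph0 mulr0.
Qed.

(** Applying the derivation to Y_i + t F_i(Y) = X_i, the terms t F_i(Y) and X_i
    contribute t F_i(Y) and X_i - Y_i besides the chain rule term; these cancel by
    the same equation, and delta Y_i = - t sum_j (d_j F_i)(Y) delta Y_j remains. *)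
Lemma transport_Y i : transport (tnth Y i) = 0.
Proof.
apply: (@fps_contraction_eq0 _ _ (fun i j => phi (tnth F i)^`M(j)) 
  (fun i => transport (tnth Y i))) => {}i.
have := congr1 transport (right_inverse_eq i).
rewrite (sderD transport_derivation) transport_t transport_const.
rewrite (fps_subst_chain _ _ transport_derivation).
rewrite -(right_inverse_eq i) [X in _ = X -> _]addrAC subrr add0r.
by rewrite addrCA -[X in _ = X -> _]addr0 => /addrI/eqP; rewrite addr_eq0 => /eqP.
Qed.

(** The equation t phi' = U phi: the chain rule extends [transport_Y] from the
    variables to all polynomials. *)
Lemma flow_left_subst m p :
  fps_coef (phi p) m *+ m =
  \sum_(r < m) vfield (Fs r.+1) (fps_coef (phi p) (m - r.+1)%N).
Proof.
have : transport (phi p) = 0.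
  rewrite (fps_subst_chain _ _ transport_derivation) big1 // => j _.
  by rewrite transport_Y mulr0.
move/eqP; rewrite subr_eq0 => /eqP/(congr1 (fun a => fps_coef a m)) /= ->.
rewrite fps_coef_sum /vfield [RHS]exchange_big; apply: eq_bigr => i _ /=.
rewrite big_ord_recl tnth_mktuple /= subrr mul0r add0r.
by apply: eq_bigr => r _; rewrite /= subr0.
Qed.

(** The coefficients J^r F of the right power D^[r+1]. *)
Fixpoint power_field r : n.-tuple P :=
  if r is r'.+1 then [tuple vfield (power_field r') (tnth F i) | i < n] else F.

Lemma rpow_vfield r : rpow (vfield F) r.+1 = vfield (power_field r).
Proof.
rewrite /rpow /=; elim: r => //= r ->; rewrite /lsprod; congr vfield.
by apply: eq_mktuple => i; rewrite vfieldU.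
Qed.

(** The vector J(Y)^r (t dY/dt). *)
Fixpoint jacobian_iter r (i : 'I_n) : fps P :=
  if r is r'.+1 then \sum_(j < n) phi (tnth F i)^`M(j) * jacobian_iter r' j
  else euler (tnth Y i).

(** For r = 0 this is t d/dt applied to Y + t F(Y) = X; the general case is its
    image under J(Y)^r. *)
Lemma jacobian_iter_step r i : jacobian_iter r i =
  - (t * (phi (tnth (power_field r) i) + jacobian_iter r.+1 i)).
Proof.
elim: r i => [|r IHr] i.
  have := congr1 (@euler P) (right_inverse_eq i).
  rewrite eulerD eulerM euler_t euler_const (fps_subst_chain _ _ (@euler_derivation k n)).
  by rewrite -mulrDr => /eqP; rewrite addr_eq0 => /eqP.
rewrite tnth_mktuple /vfield fps_subst_sum.
change (jacobian_iter r.+1 i) with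
  (\sum_(j < n) phi (tnth F i)^`M(j) * jacobian_iter r j).
change (jacobian_iter r.+2 i) with
  (\sum_(j < n) phi (tnth F i)^`M(j) * jacobian_iter r.+1 j).
rewrite -big_split mulr_sumr -sumrN; apply: eq_bigr => j _.
rewrite IHr fps_substM; move: (phi _) (phi _) (jacobian_iter _ _) => a b c /=.
by ring.
Qed.

Lemma jacobian_iter0 N i : jacobian_iter 0 i =
  \sum_(r < N) (- t) ^+ r.+1 * phi (tnth (power_field r) i)
    + (- t) ^+ N * jacobian_iter N i.
Proof.
elim: N => [|N ->]; first by rewrite big_ord0 add0r mul1r.
by rewrite big_ord_recr /= [in LHS]jacobian_iter_step exprS /=; ring.
Qed.

(** The geometric series for t phi' = phi V, cut at order N so that the sum stays
    finite; the remainder vanishes to order N in t. *)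
Lemma euler_subst_unroll N p : exists a : fps P,
  euler (phi p) =
  \sum_(r < N) (- t) ^+ r.+1 * phi (vfield (power_field r) p) + (- t) ^+ N * a.
Proof.
exists (\sum_(j < n) phi p^`M(j) * jacobian_iter N j).
rewrite (fps_subst_chain _ _ (@euler_derivation k n)) mulr_sumr.
rewrite (eq_bigr (fun r : 'I_N => \sum_(j < n)
    (- t) ^+ r.+1 * (phi (tnth (power_field r) j) * phi p^`M(j)))); last first.
  move=> r _; rewrite /vfield fps_subst_sum mulr_sumr.
  by apply: eq_bigr => j _; rewrite fps_substM.
rewrite exchange_big -big_split; apply: eq_bigr => j _.
rewrite -[euler _]/(jacobian_iter 0 j) (jacobian_iter0 N).
exact: sum_scale.
Qed.

(** The equation t phi' = phi V. *)
Lemma flow_right_subst m p :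
  fps_coef (phi p) m *+ m =
  \sum_(r < m) fps_coef (phi ((-1) ^+ r.+1 *: rpow (vfield F) r.+1 p)) (m - r.+1)%N.
Proof.
(* Cutting at N = m + 1 kills both the remainder and the term r = m. *)
have [a] := euler_subst_unroll m.+1 p.
move/(congr1 (fun b => fps_coef b m)).
rewrite [fps_coef (euler _) m]/= => ->; rewrite fps_coefD.
rewrite fps_coef_NtXM ltnn addr0 fps_coef_sum.
rewrite (eq_bigr _ (fun (r : 'I_m.+1) _ =>
  fps_coef_NtXM (phi (vfield (power_field r) p)) r.+1 m)).
rewrite big_ord_recr /= ltnn addr0.
apply: eq_bigr => r _; rewrite ltn_ord [RHS]fps_coef_substZ rpow_vfield.
by rewrite -mul_mpolyC rmorphXn rmorphN1.
Qed.

End Inverse.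

Theorem theorem2 (k : fieldType) (hk : [pchar k] =i pred0) (n : nat)
    (F : n.-tuple {mpoly k[n]}) (Fs : nat -> n.-tuple {mpoly k[n]})
    (hFs : formal_inverse F Fs) :
  L_of (vfield F) =
  lie_generated (fun E => exists2 m : nat, (0 < m)%N & E = vfield (Fs m)).
Proof.
(* The signs in w come from V = sum (-t)^r D^[r]; they do not affect the span. *)
pose phi m p := fps_coef (fps_subst (X_plus_series Fs) p) m.
pose w r p := (-1) ^+ r.+1 *: rpow (vfield F) r.+1 p.
pose u r := vfield (Fs r.+1).
have phi0 p : phi 0 p = p by exact: fps_coef0_subst.
have phiD m p q : phi m (p + q) = phi m p + phi m q.
  by rewrite /phi fps_substD.
have gen L : lie_subalgebra L -> (forall r, L (w r)) <-> (forall r, L (u r)).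
  move=> lieL; apply: (flow_generators hk lieL phi0 phiD) => m p.
    exact: flow_right_subst hFs.1 m p.
  exact: flow_left_subst hFs.1 m p.
have genw L : lie_subalgebra L ->
    (forall E, (exists2 m, (0 < m)%N & E = rpow (vfield F) m) -> L E) <->
    (forall r, L (w r)).
  move=> lieL; split=> [LE r|Lw E [[//|m] _ ->]].
    by apply: (lie_scale lieL); apply: LE; exists r.+1.
  have := lie_scale lieL ((-1) ^+ m.+1) (Lw m).
  congr L; apply: funext => p.
  by rewrite /w scalerA -exprMn mulrNN mulr1 expr1n scale1r.
have genu L :
    (forall E, (exists2 m, (0 < m)%N & E = vfield (Fs m)) -> L E) <->
    (forall r, L (u r)).
  split=> [LE r|Lu E [[//|m] _ ->]]; last exact: Lu.
  by apply: LE; exists r.+1.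
rewrite /L_of /lie_generated; apply: funext => E; apply: propext.
split=> LE L lieL LS; apply: LE => //.
  by apply/(genw L lieL)/(gen L lieL)/genu.
by apply/genu/(gen L lieL)/(genw L lieL).
Qed.
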